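(* Let $Q(\alpha)=\alpha^n+a_1\alpha^{n-1}+\dots+a_n$ be a polynomial of degree $n$ with real coefficients, with roots $\alpha_1,\dots,\alpha_n\in\mathbb{C}$ (listed with multiplicity), and let $s_k=\sum_{i=1}^n\alpha_i^k$ for $k\in\mathbb{N}$. If any one of the following inequalities holds: (i) $ns_2<s_1^2$; (ii) $ns_4<s_2^2$; (iii) $s_2s_4<s_3^2$, then $Q$ has at least one complex root with non-zero imaginary part.
   Context: The power sums $s_k$ are real numbers because $Q$ has real coefficients. *)

(* Defs.v *)
From mathcomp Require Import all_boot all_order all_algebra.
From mathcomp Require Import complex reals.

Set Implicit Arguments.
Unset Strict Implicit.
Unset Printing Implicit Defensive.

Import Order.TTheory GRing.Theory Num.Theory.
Local Open Scope ring_scope.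
Local Open Scope complex_scope.

Definition cpoly (R : realType) (Q : {poly R}) : {poly R[i]} :=
  map_poly (real_complex R) Q.

Definition is_root_list (R : realType) (n : nat) (Q : {poly R})
    (alpha : 'I_n -> R[i]) : Prop :=
  cpoly Q = \prod_(i < n) ('X - (alpha i)%:P).

Definition cpower_sum (R : realType) (n : nat) (alpha : 'I_n -> R[i])
    (k : nat) : R[i] := \sum_(i < n) alpha i ^+ k.

(* The power sum as an element of R: for the roots of a real polynomial the
   imaginary part is zero, so nothing is lost (power_sumE below). *)
Definition power_sum (R : realType) (n : nat) (alpha : 'I_n -> R[i])
    (k : nat) : R := complex.Re (cpower_sum alpha k).

Lemma power_sumE (R : realType) (n : nat) (Q : {poly R})
    (alpha : 'I_n -> R[i]) (k : nat) :
  is_root_list Q alpha -> (power_sum alpha k)%:C = cpower_sum alpha k.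
Proof.
move=> rootsQ; pose s := [seq alpha i | i <- enum 'I_n].
have prodE (t : 'I_n -> R[i]) : \prod_(i < n) ('X - (t i)%:P) =
    \prod_(z <- [seq t i | i <- enum 'I_n]) ('X - z%:P).
  by rewrite big_map big_enum.
have conjQ : map_poly conjc (cpoly Q) = cpoly Q.
  by apply/polyP => i; rewrite !coef_map /= oppr0.
have perm_conj : perm_eq s [seq (alpha i)^* | i <- enum 'I_n].
  apply: prod_XsubC_eq; rewrite -!prodE -rootsQ -conjQ rootsQ rmorph_prod.
  by apply: eq_bigr => i _; rewrite rmorphB /= map_polyX map_polyC.
have : conjc (cpower_sum alpha k) = cpower_sum alpha k.
  rewrite /cpower_sum rmorph_sum /=.
  have sumE (t : 'I_n -> R[i]) : \sum_(i < n) t i ^+ k =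
      \sum_(z <- [seq t i | i <- enum 'I_n]) z ^+ k.
    by rewrite big_map big_enum.
  rewrite [RHS]sumE (perm_big _ perm_conj) /= -sumE.
  by apply: eq_bigr => i _; rewrite rmorphXn.
rewrite /power_sum; case: (cpower_sum alpha k) => x y /= [] /eqP.
by rewrite eq_sym -addr_eq0 -mulr2n mulrn_eq0 /= => /eqP ->.
Qed.

(* Main.v *)
Require Import Defs.
From mathcomp Require Import all_boot all_order all_algebra.
From mathcomp Require Import complex reals ring.

Set Implicit Arguments.
Unset Strict Implicit.
Unset Printing Implicit Defensive.

Import Order.TTheory GRing.Theory Num.Theory.
Local Open Scope ring_scope.
Local Open Scope complex_scope.

(** If every root were real, the power sums would be inner products of real
    vectors: with [x] the vector of roots, [s (p + q)] is the inner product
    of [x ^+ p] and [x ^+ q], taken entrywise.  The Cauchy-Schwarz inequality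
    then gives [s (p + q) ^+ 2 <= s (p * 2) * s (q * 2)], and the choices
    [(p, q) = (0, 1), (0, 2), (1, 2)] contradict (i), (ii), (iii) in turn,
    since [s 0 = n] (with the convention [0 ^+ 0 = 1]).  So some root has
    non-zero imaginary part. *)

(** Lagrange's identity: twice the difference of the two sides is the sum of
    the squares [(u i * v j - u j * v i) ^+ 2]. *)
Lemma Cauchy_Schwarz_sum (R : realDomainType) (I : finType) (u v : I -> R) :
  (\sum_i u i * v i) ^+ 2 <= (\sum_i u i ^+ 2) * (\sum_i v i ^+ 2).
Proof.
have sumM (f g : I -> R) :
    (\sum_i f i) * (\sum_j g j) = \sum_i \sum_j f i * g j.
  by rewrite mulr_suml; apply: eq_bigr => i _; rewrite mulr_sumr.
have lagrange : \sum_i \sum_j (u i * v j - u j * v i) ^+ 2 =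
    ((\sum_i u i ^+ 2) * (\sum_i v i ^+ 2) - (\sum_i u i * v i) ^+ 2) *+ 2.
  rewrite mulrnBl [in X in _ - X]expr2 mulr2n {2}[_ * \sum_i v i ^+ 2]mulrC.
  rewrite !sumM -sumrMnl -big_split -sumrB /=; apply: eq_bigr => i _.
  rewrite -sumrMnl -big_split -sumrB /=.
  by apply: eq_bigr => j _; ring.
rewrite -subr_ge0 -(pmulrn_lge0 _ (ltn0Sn 1)) -lagrange.
by apply: sumr_ge0 => i _; apply: sumr_ge0 => j _; apply: sqr_ge0.
Qed.

Lemma power_sum_real (R : realType) (n : nat) (x : 'I_n -> R)
    (alpha : 'I_n -> R[i]) (k : nat) :
  (forall i, alpha i = (x i)%:C) -> power_sum alpha k = \sum_i x i ^+ k.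
Proof.
move=> alphaE; rewrite /power_sum /cpower_sum.
under eq_bigr do rewrite alphaE -rmorphXn.
by rewrite -rmorph_sum.
Qed.

(** Cauchy-Schwarz for the entrywise powers [x ^+ p] and [x ^+ q] of the real
    vector underlying [alpha].  The outer indices must be even: at odd ones the
    power sums are not sums of squares and may be negative. *)
Lemma power_sum_Cauchy_Schwarz (R : realType) (n : nat) (alpha : 'I_n -> R[i])
    (p q : nat) :
  (forall i, complex.Im (alpha i) = 0) ->
  power_sum alpha (p + q) ^+ 2
    <= power_sum alpha (p * 2) * power_sum alpha (q * 2).
Proof.
move=> alpha_real; pose x i := complex.Re (alpha i).
have alphaE i : alpha i = (x i)%:C.
  by rewrite /x; case: (alpha i) (alpha_real i) => a b /= ->.
rewrite !(power_sum_real _ alphaE).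
under eq_bigr do rewrite exprD.
under [X in _ <= X * _]eq_bigr do rewrite exprM.
under [X in _ <= _ * X]eq_bigr do rewrite exprM.
exact: Cauchy_Schwarz_sum.
Qed.

Lemma power_sum0 (R : realType) (n : nat) (alpha : 'I_n -> R[i]) :
  power_sum alpha 0 = n%:R.
Proof.
rewrite /power_sum /cpower_sum.
under eq_bigr do rewrite expr0.
by rewrite sumr_const card_ord -(rmorph_nat (real_complex R)).
Qed.

Theorem proposition2p2 (R : realType) (n : nat) (Q : {poly R})
    (alpha : 'I_n -> R[i])
    (Q_monic : Q \is monic) (degQ : size Q = n.+1)
    (rootsQ : is_root_list Q alpha) :
  let s := power_sum alpha in
  [\/ n%:R * s 2%N < s 1%N ^+ 2,
      n%:R * s 4%N < s 2%N ^+ 2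
    | s 2%N * s 4%N < s 3%N ^+ 2] ->
  exists z : R[i], root (cpoly Q) z /\ complex.Im z != 0.
Proof.
move=> s s_lt.
have [/existsP[i Im_i]|/existsPn all_real] :=
  boolP [exists i, complex.Im (alpha i) != 0].
  exists (alpha i); split=> //.
  by rewrite rootsQ /root horner_prod (bigD1 i) //= hornerXsubC subrr mul0r.
have alpha_real i : complex.Im (alpha i) = 0.
  by apply/eqP; rewrite -[_ == _]negbK.
have s_le p q := power_sum_Cauchy_Schwarz p q alpha_real.
rewrite /s -(power_sum0 alpha) in s_lt.
case: s_lt; rewrite ltNge => /negP[].
- exact: (s_le 0 1)%N.
- exact: (s_le 0 2)%N.
- exact: (s_le 1 2)%N.
Qed.
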